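(* For every $s\in(-\infty,\infty)$ and every $n\ge2$, the measure $\mathcal W_s(P\Vert Q)$ is nonnegative on $\Gamma_n\times\Gamma_n$ and is convex in the pair of probability distributions $(P,Q)\in\Gamma_n\times\Gamma_n$.
   Context: $\Gamma_n=\{P=(p_1,\dots,p_n): p_i>0,\ \sum_{i=1}^n p_i=1\}$. For $P,Q\in\Gamma_n$ and $s\in\mathbb{R}$, $$\mathcal W_s(P\Vert Q)=\begin{cases}[s(s-1)]^{-1}\left[\sum_{i=1}^n\left(\frac{p_i^{1-s}+q_i^{1-s}}{2}\right)\left(\frac{p_i+q_i}{2}\right)^s-1\right], & s\ne0,1,\\[4pt] \frac12\left[\sum_{i=1}^n p_i\ln\left(\frac{2p_i}{p_i+q_i}\right)+\sum_{i=1}^n q_i\ln\left(\frac{2q_i}{p_i+q_i}\right)\right], & s=0,\\[4pt] \sum_{i=1}^n\left(\frac{p_i+q_i}{2}\right)\ln\left(\frac{p_i+q_i}{2\sqrt{p_iq_i}}\right), & s=1.\end{cases}$$ *)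

(* Defs.v *)
From mathcomp Require Import all_boot all_order all_algebra.
From mathcomp Require Import all_classical all_reals.
From mathcomp Require Import exp convex.

Set Implicit Arguments.
Unset Strict Implicit.
Unset Printing Implicit Defensive.

Import Order.TTheory GRing.Theory Num.Theory.

Local Open Scope classical_set_scope.
Local Open Scope ring_scope.

Definition Gamma (R : realType) (n : nat) : set 'rV[R]_n :=
  [set P | (forall i, 0 < P 0 i) /\ \sum_(i < n) P 0 i = 1].

Definition W (R : realType) (n : nat) (s : R) (P Q : 'rV[R]_n) : R :=
  if s == 0 then
    2^-1 * (\sum_(i < n) P 0 i * ln (2 * P 0 i / (P 0 i + Q 0 i))
          + \sum_(i < n) Q 0 i * ln (2 * Q 0 i / (P 0 i + Q 0 i)))
  else if s == 1 then
    \sum_(i < n) (P 0 i + Q 0 i) / 2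
                 * ln ((P 0 i + Q 0 i) / (2 * Num.sqrt (P 0 i * Q 0 i)))
  else
    (s * (s - 1))^-1
      * (\sum_(i < n) (P 0 i `^ (1 - s) + Q 0 i `^ (1 - s)) / 2
                      * ((P 0 i + Q 0 i) / 2) `^ s
         - 1).

(* Main.v *)
Require Import Defs.
From mathcomp Require Import all_boot all_order all_algebra.
From mathcomp Require Import all_classical all_reals.
From mathcomp Require Import exp convex.
From mathcomp Require Import interval_inference unstable ring lra.

Set Implicit Arguments.
Unset Strict Implicit.
Unset Printing Implicit Defensive.

Import Order.TTheory GRing.Theory Num.Theory.

Local Open Scope classical_set_scope.
Local Open Scope ring_scope.

(** Write [A = (p + q) / 2] for the coordinatewise midpoint.  Up to an additive
constant, [W s] is the sum over the coordinates of the mean of [k p A] and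
[k q A], where [k = kernel s] is, for generic [s], the function
[x `^ (1 - s) * y `^ s / (s * (s - 1))]; the logarithmic values of [s] give
[x ln (x / y)] and [y ln (y / x)].  The constant is [k 1 1] ([W_kernel]).

The kernel is homogeneous of degree one, and at each point of the open quadrant
it has a supporting linear functional, that is, a linear minorant that agrees
with it there ([supported_kernel]).  For generic [s] this is Bernoulli's
inequality with a real exponent ([bernoulli_powR]), a form of weighted AM-GM;
for [s = 0, 1] it is [ln u >= 1 - 1/u].

Both conclusions follow from the supporting functionals.  The one at (1, 1),
summed over the coordinates of two probability vectors, is worth exactly
[k 1 1], because [p], [q] and [A] all have total mass 1; hence [W s >= 0].  The
one at an average of two points shows that [k] is jointly convex, and
convexity of [W s] follows because [A] depends linearly on (p, q). *)

Section Kernel.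
Variable R : realType.
Implicit Types s u x y t : R.

(** Convexity of the exponential, rescaled by [ln u].  All signs of Bernoulli's
inequality come from it, by choosing which of the exponents 0, 1 and [s] lies
between the other two. *)
Lemma powR_exponent_convex u t a b : 0 < u -> 0 <= t <= 1 ->
  u `^ (t * a + (1 - t) * b) <= t * u `^ a + (1 - t) * u `^ b.
Proof.
move=> u0 t01; have := convex_expR (Itv01 (andP t01).1 (andP t01).2)
  (a * ln u) (b * ln u).
rewrite !convRE /= /onem => h.
by rewrite /powR gt_eqF// mulrDl -!mulrA.
Qed.

(** Dividing by [s * (s - 1)] merges the two directions of Bernoulli's
inequality: the quantity is a second divided difference of the convex function
[e |-> u `^ e] at 0, 1 and [s]. *)
Lemma bernoulli_powR s u : s != 0 -> s != 1 -> 0 < u ->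
  0 <= (s * (s - 1))^-1 * (u `^ s - 1 - s * (u - 1)).
Proof.
move=> s0 s1 u0.
have u1 : u `^ 1 = u by rewrite powRr1 ?ltW.
have u00 : u `^ 0 = 1 by rewrite powRr0.
have [sn|sp|] := ltgtP s 0; last by move/eqP; rewrite (negPf s0).
- (* 0 = (1 - s)^-1 * s + (1 - (1 - s)^-1) * 1 lies between s and 1. *)
  have d0 : 0 < 1 - s by lra.
  have d1 : 1 - s != 0 by rewrite gt_eqF.
  have t01 : 0 <= (1 - s)^-1 <= 1.
    by rewrite invr_ge0 ltW//= invf_le1//; lra.
  have := powR_exponent_convex s 1 u0 t01.
  rewrite (_ : _ + _ * 1 = 0); last by field.
  rewrite u1 u00 => h.
  rewrite mulr_ge0// ?invr_ge0; first by nra.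
  rewrite -(ler_pM2l d0) mulrDr !mulrA mulfV// mulrBr mulr1 mulfV// in h.
  by lra.
have [sl|sg|] := ltgtP s 1; last by move/eqP; rewrite (negPf s1).
- have t01 : 0 <= s <= 1 by rewrite !ltW.
  have := powR_exponent_convex 1 0 u0 t01.
  rewrite mulr1 mulr0 addr0 u1 u00 => h.
  by rewrite mulr_le0// ?invr_le0; [nra|lra].
- (* 1 = s^-1 * s + (1 - s^-1) * 0 lies between 0 and s. *)
  have t01 : 0 <= s^-1 <= 1 by rewrite invr_ge0 ltW//= invf_le1// ltW.
  have := powR_exponent_convex s 0 u0 t01.
  rewrite mulr0 addr0 mulVf// u1 u00 => h.
  rewrite mulr_ge0// ?invr_ge0; first by nra.
  rewrite -(ler_pM2l sp) mulrDr !mulrA mulfV// mulrBr !mulr1 mulfV// in h.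
  by lra.
Qed.

Lemma ln_ge_1BV u : 0 < u -> 1 - u^-1 <= ln u.
Proof.
move=> u0; have v0 : 0 < u^-1 by rewrite invr_gt0.
have := @le_ln1Dx R (u^-1 - 1).
have -> : 1 + (u^-1 - 1) = u^-1 by ring.
by rewrite lnV ?posrE// => h; have := h ltac:(lra); lra.
Qed.

(** On a homogeneous function of degree one, such as [kernel s], a supporting
affine function is necessarily linear, so no constant term is allowed for. *)
Definition supported (F : R -> R -> R) : Prop :=
  forall x0 y0, 0 < x0 -> 0 < y0 -> exists a b,
    F x0 y0 = a * x0 + b * y0 /\
    forall x y, 0 < x -> 0 < y -> a * x + b * y <= F x y.

(** The perspective of the generator of Cressie-Read power divergences,
unnormalised: the affine terms that usually make the generator vanish to second
order at 1 contribute only a constant on probability vectors. *)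
Definition kernel s x y : R :=
  if s == 0 then x * ln (x / y)
  else if s == 1 then y * ln (y / x)
  else (s * (s - 1))^-1 * (x `^ (1 - s) * y `^ s).

(** The functional is the differential of [x ln (x / y)], and the inequality is
[ln v >= 1 - 1/v] at the ratio [v] of the slopes [x / y] and [x0 / y0]. *)
Lemma supported_x_ln_ratio : supported (fun x y => x * ln (x / y)).
Proof.
move=> x0 y0 hx0 hy0; set r := x0 / y0; have r0 : 0 < r by rewrite divr_gt0.
exists (ln r + 1), (- r); split=> [|x y hx hy].
  by rewrite /r; field; rewrite gt_eqF.
have v0 : 0 < x / y / r by rewrite !divr_gt0.
have := ln_ge_1BV v0.
rewrite ln_div ?posrE ?divr_gt0// => /(ler_wpM2l (ltW hx)).
have -> : x * (1 - (x / y / r)^-1) = x - r * y.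
  by field; rewrite !gt_eqF.
lra.
Qed.

(** The functional is again the differential at [(x0, y0)].  For generic [s],
with [r = y0 / x0] and [y / x = r * v], the gap between kernel and functional is
[x * r `^ s] times the nonnegative quantity of [bernoulli_powR] at [v]. *)
Lemma supported_kernel s : supported (kernel s).
Proof.
rewrite /kernel; have [_|s0] := eqVneq s 0; first exact: supported_x_ln_ratio.
have [_|s1] := eqVneq s 1.
  move=> x0 y0 hx0 hy0.
  have [a [b [e h]]] := supported_x_ln_ratio hy0 hx0.
  by exists b, a; split=> [|x y hx hy]; rewrite addrC//; exact: h.
have s1' : s - 1 != 0 by rewrite subr_eq0.
have perspective x y : 0 < x -> 0 < y ->
    x `^ (1 - s) * y `^ s = x * (y / x) `^ s.
  move=> hx hy; rewrite powRM ?invr_ge0 ?ltW//.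
  have -> : x `^ (1 - s) = x / x `^ s.
    by rewrite powRB ?powRr1 ?(gt_eqF hx) ?implybT// ltW.
  by rewrite -(powR_inv1 (ltW hx)) -powRrM mulN1r powRN; ring.
move=> x0 y0 hx0 hy0; set r := y0 / x0; have r0 : 0 < r by rewrite divr_gt0.
exists ((s * (s - 1))^-1 * ((1 - s) * r `^ s)),
  ((s * (s - 1))^-1 * (s * (r `^ s / r))); split=> [|x y hx hy].
  rewrite perspective// -/r.
  have -> : y0 = r * x0 by rewrite /r; field; rewrite gt_eqF.
  by field; rewrite s0 s1' gt_eqF.
rewrite perspective//; set v := y / x / r.
have v0 : 0 < v by rewrite !divr_gt0.
have -> : y / x = r * v by rewrite /v; field; rewrite !gt_eqF.
rewrite (powRM _ (ltW r0) (ltW v0)).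
have -> : y = r * v * x by rewrite /v; field; rewrite !gt_eqF.
rewrite -subr_ge0.
have := mulr_ge0 (mulr_ge0 (ltW hx) (powR_ge0 r s))
                 (bernoulli_powR s0 s1 v0).
congr (_ <= _); field.
by rewrite s0 s1' gt_eqF.
Qed.

(** The functional supporting [F] at the average point lies below [F] at both
endpoints, and linear functionals commute with averages. *)
Lemma supported_convex F (t : {i01 R}) (x1 x2 y1 y2 : R^o) : supported F ->
  0 < x1 -> 0 < x2 -> 0 < y1 -> 0 < y2 ->
  F (conv t x1 x2) (conv t y1 y2) <=
    t%:num * F x1 y1 + (1 - t%:num) * F x2 y2.
Proof.
move=> supF hx1 hx2 hy1 hy2.
have [a [b [-> h]]] := supF _ _ (convR_gt0 t hx1 hx2) (convR_gt0 t hy1 hy2).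
have t0 : 0 <= t%:num by [].
have t1 : 0 <= 1 - t%:num by rewrite subr_ge0.
have := lerD (ler_wpM2l t0 (h _ _ hx1 hy1)) (ler_wpM2l t1 (h _ _ hx2 hy2)).
by apply: le_trans; rewrite !convRE /onem; lra.
Qed.

(** For [s = 1] the square root in [W] comes from averaging [ln (A / p)] and
[ln (A / q)]; for [s = 0, 1] the constant [kernel s 1 1] is 0, and otherwise it
is the subtracted 1 of [W] divided by [s * (s - 1)]. *)
Lemma W_kernel n s (P Q : 'rV[R]_n) :
  (forall i, 0 < P 0 i) -> (forall i, 0 < Q 0 i) ->
  W s P Q =
  \sum_(i < n) (kernel s (P 0 i) ((P 0 i + Q 0 i) / 2)
                + kernel s (Q 0 i) ((P 0 i + Q 0 i) / 2)) / 2
  - kernel s 1 1.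
Proof.
move=> hP hQ; rewrite /W /kernel.
case: ifP => _.
  rewrite divr1 ln1 mulr0 subr0 -big_split/= mulr_sumr.
  apply: eq_bigr => i _; have p0 := hP i; have q0 := hQ i.
  have s0 : 0 < P 0 i + Q 0 i by rewrite addr_gt0.
  rewrite mulrC; congr ((_ * ln _ + _ * ln _) * _); field; rewrite gt_eqF//.
case: ifP => _.
  rewrite divr1 ln1 mulr0 subr0.
  apply: eq_bigr => i _; have p0 := hP i; have q0 := hQ i.
  have s0 : 0 < P 0 i + Q 0 i by rewrite addr_gt0.
  have -> : (P 0 i + Q 0 i) / (2 * Num.sqrt (P 0 i * Q 0 i)) =
     (P 0 i + Q 0 i) / 2 / Num.sqrt (P 0 i * Q 0 i).
    by rewrite invfM mulrA.
  rewrite -powR12_sqrt ?mulr_ge0 ?ltW//.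
  rewrite !ln_div ?posrE ?powR_gt0 ?divr_gt0 ?mulr_gt0//.
  by rewrite ln_powR lnM ?posrE//; field.
rewrite !powR1 !mulr1 mulrBr mulr1 mulr_sumr; congr (_ - _).
by apply: eq_bigr => i _; ring.
Qed.

(** The bound is the functional [a, b] supporting the kernel at (1, 1): its sum
over the coordinates is [a + b = kernel s 1 1]. *)
Lemma W_ge0 n s (P Q : 'rV[R]_n) : Gamma P -> Gamma Q -> 0 <= W s P Q.
Proof.
move=> [hP sP] [hQ sQ]; rewrite W_kernel// subr_ge0.
have [a [b [-> h]]] := supported_kernel s (@ltr01 R) (@ltr01 R).
have -> : a * 1 + b * 1 =
    \sum_(i < n) (a * P 0 i + b * ((P 0 i + Q 0 i) / 2)
      + (a * Q 0 i + b * ((P 0 i + Q 0 i) / 2))) / 2.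
  rewrite -mulr_suml !big_split/= -!mulr_sumr -!mulr_suml big_split/= sP sQ.
  by field.
apply: ler_sum => i _; rewrite ler_pM2r ?invr_gt0// lerD// h//.
all: by rewrite divr_gt0 ?addr_gt0.
Qed.

Lemma W_convex n s : @convex_function R ('rV[R]_n * 'rV[R]_n)%type
  (@Gamma R n `*` @Gamma R n) (fun PQ => W s PQ.1 PQ.2).
Proof.
move=> t [P1 Q1] [P2 Q2]; rewrite !inE/= => -[[hP1 _] [hQ1 _]] [[hP2 _] [hQ2 _]].
have convE (A B : 'rV[R]_n) i :
    (t%:num *: A + (t%:num).~ *: B) 0 i = conv t (A 0 i : R^o) (B 0 i : R^o).
  by rewrite !mxE.
have hP i : 0 < (t%:num *: P1 + (t%:num).~ *: P2) 0 i.
  by rewrite convE; exact: convR_gt0.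
have hQ i : 0 < (t%:num *: Q1 + (t%:num).~ *: Q2) 0 i.
  by rewrite convE; exact: convR_gt0.
rewrite convRE !W_kernel// {hP hQ}.
have -> (a b c : R) : t%:num * (a - c) + (t%:num).~ * (b - c)
    = t%:num * a + (t%:num).~ * b - c by rewrite /onem; ring.
rewrite lerD2r !mulr_sumr -big_split/=; apply: ler_sum => i _.
rewrite !convE.
set p1 := P1 0 i; set p2 := P2 0 i; set q1 := Q1 0 i; set q2 := Q2 0 i.
have -> : (conv t (p1 : R^o) (p2 : R^o) + conv t (q1 : R^o) (q2 : R^o)) / 2 =
    conv t ((p1 + q1) / 2 : R^o) ((p2 + q2) / 2 : R^o).
  by rewrite !convRE; ring.
have m1 : 0 < (p1 + q1) / 2 by rewrite divr_gt0// addr_gt0 ?hP1 ?hQ1.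
have m2 : 0 < (p2 + q2) / 2 by rewrite divr_gt0// addr_gt0 ?hP2 ?hQ2.
have := supported_convex t (supported_kernel s) (hP1 i) (hP2 i) m1 m2.
have := supported_convex t (supported_kernel s) (hQ1 i) (hQ2 i) m1 m2.
rewrite -/p1 -/p2 -/q1 -/q2 /onem.
lra.
Qed.

End Kernel.

Theorem mainTheorem5 (R : realType) (s : R) (n : nat) (hn : (2 <= n)%N) :
  (forall P Q : 'rV[R]_n, Gamma P -> Gamma Q -> 0 <= W s P Q) /\
  @convex_function R ('rV[R]_n * 'rV[R]_n)%type
    (@Gamma R n `*` @Gamma R n) (fun PQ => W s PQ.1 PQ.2).
Proof.
by split=> [P Q|]; [exact: W_ge0 | exact: W_convex].
Qed.
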